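(* There exists an absolute constant $C>0$ such that the following holds. Let $X$ be a finite set, let $0<p\le 1$, and let $\mathcal H\subseteq 2^X$ be a family which is not $p$-small. For each $H\in\mathcal H$, let $\lambda_H:X\to[0,1]$ be a weight vector supported on $H$ (that is, $\lambda_H(x)=0$ for $x\notin H$) with $\sum_{x\in H}\lambda_H(x)\ge 1$. Let $s$ be a positive integer. Then, with probability at least $1-2^{-s-1}$, \[ \max_{H\in\mathcal H}\ \sum_{x\in X_{Csp}\cap H}\lambda_H(x)\ \ge\ 1-2^{-s}. \]
   Context: For a finite set $X$ and $q\in[0,1]$, $X_q$ denotes the random subset of $X$ containing each element independently with probability $q$; if $q\ge 1$, $X_q$ is interpreted as the full set $X$. A family $\mathcal G\subseteq 2^X$ is a cover of $\mathcal H\subseteq 2^X$ if every $H\in\mathcal H$ contains some $G\in\mathcal G$ as a subset. A family $\mathcal H\subseteq 2^X$ is $p$-small if it has a cover $\mathcal G\subseteq 2^X$ with $\sum_{G\in\mathcal G}p^{|G|}\le \tfrac12$. *)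

(* Defs.v *)
From mathcomp Require Import all_boot all_order all_algebra.
From mathcomp Require Import reals.

Set Implicit Arguments.
Unset Strict Implicit.
Unset Printing Implicit Defensive.

Import Order.TTheory GRing.Theory Num.Theory.
Local Open Scope ring_scope.

Section Definitions.
Variables (R : realType) (T : finType).
Implicit Types (p q : R) (W : {set T}) (GG HH : {set {set T}}).

(* The probability that the random subset T_q equals W. Truncating q at 1
   makes T_q the full set when q >= 1. *)
Definition random_subset_mass q W : R :=
  \prod_(x : T) (if x \in W then Num.min q 1 else 1 - Num.min q 1).

Definition random_subset_prob q (E : pred {set T}) : R :=
  \sum_(W : {set T} | E W) random_subset_mass q W.

Definition is_cover GG HH : Prop :=
  forall H, H \in HH -> exists2 G, G \in GG & G \subset H.

Definition p_small p HH : Prop :=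
  exists2 GG, is_cover GG HH & \sum_(G in GG) p ^+ #|G| <= 1 / 2.

(* The default value 0 is immaterial for a nonempty family and nonnegative
   weights; a family that is not p-small is nonempty. *)
Definition max_weight (lambda : {set T} -> T -> R) HH W : R :=
  \big[Num.max/0]_(H in HH) \sum_(x in W :&: H) lambda H x.

End Definitions.

(* Main.v *)
(** Only the order of the points of each H by decreasing weight matters: cut H
    into blocks of ranks [M^b, M^(b+1)) with M = 2^(s+2). If the random set misses
    at most 2 M^(b-1) points of each block b >= 1 of some H, and none of block 0,
    then comparing each block with the previous one shows that the missed weight
    is at most a fraction 2^-s of the total.

    Expose the random set in N = 2(s+2) rounds. For H0 in the family, consider
    fragments t inside H0 such that adding the points of t to appropriate rounds
    lets some H in the family satisfy all the requirements relevant to fragments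
    of size 2^e. At scale e, blocks much smaller than 2^e are handled in the first
    round, at most two blocks are in an intermediate round, and larger blocks are
    finished up to their allowance. As in the Park-Pham argument, an extremal
    fragment can be recovered, at the cost of a factor 256 per point, from the
    exposed sets enlarged by the fragment. Hence the extremal fragments with at
    least 2^e points have small expected cost when the density of a round is a
    large multiple of p. An extremal fragment with fewer than 2^e points satisfies
    the requirements at scale e - 1. If the fragments left over at scale about
    log s had a cover of cost at most 1/4, then together with the large fragments
    the original family would be p-small. The left-over fragments have at most 2s
    points, and 5s + 2 further rounds, each either shortening the fragments by one
    point or failing with probability at most 1/4, produce one of them except with
    probability 2^(-s-2). *)
Require Import Defs.
From mathcomp Require Import all_boot all_order all_algebra.
From mathcomp Require Import reals.
From mathcomp Require Import zify ring lra.

Set Implicit Arguments.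
Unset Strict Implicit.
Unset Printing Implicit Defensive.

Import Order.TTheory GRing.Theory Num.Theory.
Local Open Scope ring_scope.

(** * Random subsets *)

Section Probability.
Variables (R : realType) (T : finType).
Implicit Types (p q : R) (A B W : {set T}) (F : {set T} -> R).

(** The labellings that yield a given set [A] form a product set, so their mass factors by
    distributivity. This handles both unions of two independent random sets and the set covered by
    the rounds. *)
Lemma sum_prod_ffun_push (Omega : finType) (w : Omega -> R) (h : pred Omega) F :
  \sum_(f : {ffun T -> Omega}) (\prod_x w (f x)) * F [set x | h (f x)] =
  \sum_(A : {set T})
    (\prod_x (if x \in A then \sum_(v | h v) w v else \sum_(v | ~~ h v) w v)) * F A.
Proof.
rewrite (partition_big (fun f : {ffun T -> Omega} => [set x | h (f x)]) xpredT) //=.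
apply: eq_bigr => A _.
under eq_bigr => f /eqP fA do rewrite fA.
rewrite -big_distrl /=; congr (_ * _).
transitivity (\prod_x \sum_(v | h v == (x \in A)) w v); last first.
  by apply: eq_bigr => x _; case: (x \in A); apply: eq_bigl => v; case: (h v).
rewrite bigA_distr_big_dep /=; apply: eq_bigl => f.
apply/eqP/familyP => [<- x|fA]; first by rewrite unfold_in /= inE.
by apply/setP => x; rewrite inE; have := fA x; rewrite unfold_in => /eqP.
Qed.

Lemma mass_ge0 q W : 0 <= q -> 0 <= random_subset_mass q W.
Proof.
move=> q0; apply: prodr_ge0 => x _.
have q1 : Num.min q 1 <= 1 by rewrite ge_min lexx orbT.
by case: ifP => _; [rewrite le_min q0 ler01 | rewrite subr_ge0].
Qed.

Lemma sum_mass q : \sum_(W : {set T}) random_subset_mass q W = 1.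
Proof.
pose w (b : bool) := if b then Num.min q 1 else 1 - Num.min q 1.
have w1 : \sum_b w b = 1 by rewrite big_bool /w /=; ring.
have := sum_prod_ffun_push w id (fun => 1).
under eq_bigr do rewrite mulr1.
rewrite -(bigA_distr_bigA (fun (_ : T) b => w b)) /= big1 => [H|x _]; last exact: w1.
rewrite [RHS]H; apply: eq_bigr => A _; rewrite mulr1.
apply: eq_bigr => x _; case: (x \in A).
  by rewrite (big_pred1 true) // => -[].
by rewrite (big_pred1 false) // => -[].
Qed.

Lemma prob_ge0 q (E : pred {set T}) : 0 <= q -> 0 <= random_subset_prob q E.
Proof. by move=> q0; apply: sumr_ge0 => W _; exact: mass_ge0. Qed.

Lemma probC q (E : pred {set T}) :
  random_subset_prob q E + random_subset_prob q (fun W => ~~ E W) = 1.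
Proof. by rewrite -(sum_mass q) (bigID E). Qed.

Lemma le_prob q (E E' : pred {set T}) : 0 <= q -> (forall W, E W -> E' W) ->
  random_subset_prob q E <= random_subset_prob q E'.
Proof.
move=> q0 EE'; rewrite /random_subset_prob [leLHS]big_mkcond [leRHS]big_mkcond.
apply: ler_sum => W _; case: ifP => [/EE' -> //|_].
by case: ifP => // _; exact: mass_ge0.
Qed.

Lemma prob_le1 q (E : pred {set T}) : 0 <= q -> random_subset_prob q E <= 1.
Proof. by move=> q0; rewrite -(probC q E) lerDl prob_ge0. Qed.

Lemma prob_as_sum q (E : pred {set T}) :
  random_subset_prob q E = \sum_W random_subset_mass q W * (E W)%:R.
Proof.
rewrite /random_subset_prob big_mkcond; apply: eq_bigr => W _.
by case: (E W); rewrite ?mulr1 ?mulr0.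
Qed.

Lemma mass_union q1 q2 F : 0 <= q1 <= 1 -> 0 <= q2 <= 1 ->
  \sum_A \sum_B random_subset_mass q1 A * random_subset_mass q2 B * F (A :|: B) =
  \sum_C random_subset_mass (q1 + q2 - q1 * q2) C * F C.
Proof.
move=> /andP[q10 q11] /andP[q20 q21].
pose wt q (b : bool) : R := if b then q else 1 - q.
pose w (v : bool * bool) := wt q1 v.1 * wt q2 v.2.
have q3 : q1 + q2 - q1 * q2 <= 1 by nra.
have := sum_prod_ffun_push w (fun v => v.1 || v.2) F.
set X := (X in X = _) => H; transitivity X.
  rewrite pair_big /= /X.
  rewrite (reindex (fun f : {ffun T -> bool * bool} =>
     ([set x | (f x).1], [set x | (f x).2]))) /=; last first.
    exists (fun AB : {set T} * {set T} => [ffun x => (x \in AB.1, x \in AB.2)]) => [f _|[A B] _] /=.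
      by apply/ffunP => x; rewrite ffunE !inE -surjective_pairing.
    by congr (_, _); apply/setP => x; rewrite inE ffunE.
  apply: eq_bigr => f _; congr (_ * F _); last by apply/setP => x; rewrite !inE.
  rewrite /random_subset_mass -big_split /=; apply: eq_bigr => x _.
  by rewrite !inE !min_l.
rewrite {}H; apply: eq_bigr => C _; congr (_ * _).
have sw (P : pred (bool * bool)) : \sum_(v | P v) w v =
   \sum_a \sum_b if P (a, b) then w (a, b) else 0.
  by rewrite big_mkcond pair_bigA; apply: eq_bigr => -[].
apply: eq_bigr => x _; rewrite min_l // !sw !big_bool /w /wt /=.
by case: ifP => _; ring.
Qed.

(** The union of two independent sets only has density [q1 + q2 - q1 * q2], and a decreasing event
    is at least as likely there as at density [q1 + q2]. *)
Lemma prob_sprinkle q1 q2 (E : pred {set T}) : 0 <= q1 -> 0 <= q2 ->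
  q1 + q2 <= 1 -> (forall W W', W \subset W' -> E W' -> E W) ->
  random_subset_prob (q1 + q2) E <=
  \sum_A random_subset_mass q1 A * random_subset_prob q2 (fun B => E (A :|: B)).
Proof.
move=> q10 q20 q12 dE.
have mono q q' : 0 <= q -> q <= q' -> q' <= 1 ->
    random_subset_prob q' E <= random_subset_prob q E.
  move=> q0 qq' q'1; have [->//|nqq'] := eqVneq q q'.
  have ql1 : q < 1 by rewrite (lt_le_trans _ q'1) // lt_neqAle nqq'.
  (* The solution of [q + d - q * d = q']: a union with an independent set of density [d] lifts
     density [q] to [q']. *)
  pose d := (q' - q) / (1 - q).
  have d0 : 0 <= d by apply: divr_ge0; lra.
  have d1 : d <= 1 by rewrite ler_pdivrMr; lra.
  have -> : q' = q + d - q * d by rewrite /d; field; lra.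
  rewrite !prob_as_sum -mass_union; [|lra|lra].
  apply: ler_sum => A _.
  under eq_bigr do rewrite -mulrA.
  rewrite -big_distrr /=; apply: ler_wpM2l; first exact: mass_ge0.
  rewrite -[leRHS]mul1r -[X in _ <= X * _](sum_mass d) big_distrl /=.
  apply: ler_sum => B _.
  apply: ler_wpM2l; first exact: mass_ge0.
  rewrite ler_nat; case EAB: (E (A :|: B)) => //.
  by rewrite (dE _ _ _ EAB) // subsetUl.
have := mono (q1 + q2 - q1 * q2) (q1 + q2).
move=> /(_ _ _ _)/le_trans; apply; [nra|nra|by []|].
rewrite prob_as_sum -mass_union; [|lra|lra].
apply: ler_sum => A _; rewrite prob_as_sum big_distrr /=.
by apply: ler_sum => B _; rewrite mulrA.
Qed.

Lemma prob_antimono q q' (E : pred {set T}) : 0 <= q -> q <= q' -> q' <= 1 ->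
  (forall W W', W \subset W' -> E W' -> E W) ->
  random_subset_prob q' E <= random_subset_prob q E.
Proof.
move=> q0 qq' q'1 dE; have -> : q' = (q' - q) + q by ring.
apply: le_trans (prob_sprinkle _ _ _ dE) _; [lra|lra|lra|].
rewrite -[leRHS]mul1r -[X in _ <= X * _](sum_mass (q' - q)) big_distrl /=; apply: ler_sum => A _.
apply: ler_wpM2l; first by apply: mass_ge0; lra.
by apply: le_prob => // B; apply: dE; exact: subsetUr.
Qed.

End Probability.

Lemma sum_markov (R : realType) (Omega : finType) (m f : Omega -> R) (d : R) :
  0 < d -> (forall w, 0 <= m w) -> (forall w, 0 <= f w) ->
  \sum_(w | d < f w) m w <= d^-1 * \sum_w m w * f w.
Proof.
move=> d0 m0 f0; rewrite mulrC ler_pdivlMr // big_distrl /= big_mkcond /=.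
apply: ler_sum => w _; case: ifP => [df|_]; last by rewrite mulr_ge0.
by rewrite ler_wpM2l // ltW.
Qed.

Lemma ler_sum_inj (R : realType) (I J : finType) (P : pred I) (Q : pred J)
    (h : I -> J) (f : J -> R) :
  {in P &, injective h} -> (forall i, P i -> Q (h i)) -> (forall j, 0 <= f j) ->
  \sum_(i | P i) f (h i) <= \sum_(j | Q j) f j.
Proof.
move=> hI PQ f0; rewrite -(big_imset _ hI) big_mkcond [leRHS]big_mkcond /=.
apply: ler_sum => j _; case: ifP => [/imsetP[i Pi ->]|_].
  by rewrite PQ.
by case: ifP.
Qed.

(** * Families of bounded size *)

Section BoundedFamilies.
Variables (R : realType) (T : finType) (p : R).
Hypothesis p0 : 0 < p.
Implicit Types (q c : R) (l m : nat) (S W : {set T}) (F G : {set {set T}}).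

Definition cost G : R := \sum_(g in G) p ^+ #|g|.

(** At [c = 1 / 2] this is the negation of [p_small]. The bound varies because each passage to
    fragments spends part of it. *)
Definition cover_free c F := forall G, is_cover G F -> c < cost G.

Lemma cost_ge0 G : 0 <= cost G.
Proof. by apply: sumr_ge0 => g _; rewrite exprn_ge0 // ltW. Qed.

Lemma costU G G' : cost (G :|: G') <= cost G + cost G'.
Proof.
rewrite /cost [\sum_(g in G :|: G') _]big_mkcond [X in _ <= X + _]big_mkcond.
rewrite [X in _ <= _ + X]big_mkcond -big_split; apply: ler_sum => g _.
have := exprn_ge0 #|g| (ltW p0); rewrite inE.
by case: (g \in G); case: (g \in G') => /=; lra.
Qed.

Lemma cover_free_neq0 c F : 0 <= c -> cover_free c F -> exists S, S \in F.
Proof.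
move=> c0 cF; apply/set0Pn/eqP => F0.
have : c < cost set0 by apply: cF => S; rewrite F0 inE.
by rewrite /cost big_set0 ltNge c0.
Qed.

Lemma cover_free_sub c d F F' G : cover_free c F -> cost G <= d ->
  (forall S, S \in F -> (exists2 g, g \in G & g \subset S) \/
                        (exists2 S', S' \in F' & S' \subset S)) ->
  cover_free (c - d) F'.
Proof.
move=> cF Gd H G' G'F'; rewrite ltrBlDr.
apply: lt_le_trans (cF (G' :|: G) _) _; last first.
  by apply: le_trans (costU _ _) _; rewrite lerD2l.
move=> S /H[[g gG gS]|[S' S'F' S'S]]; first by exists g => //; rewrite inE gG orbT.
have [g gG gS'] := G'F' _ S'F'; exists g; first by rewrite inE gG.
exact: subset_trans gS' S'S.
Qed.

Definition hits F W := [exists S in F, S \subset W].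

Lemma hitsS F W W' : W \subset W' -> hits F W -> hits F W'.
Proof.
move=> WW' /existsP[S /andP[SF SW]]; apply/existsP; exists S.
by rewrite SF (subset_trans SW).
Qed.

(** Moving a point of [S] into the set replaces a factor [1 - q <= 1] by [q]. *)
Lemma mass_add q S W : 0 < q < 1 -> [disjoint S & W] ->
  q ^+ #|S| * random_subset_mass q W <= random_subset_mass q (W :|: S).
Proof.
move=> /andP[q0 q1] SW; rewrite -prodr_const /random_subset_mass.
rewrite big_mkcond -big_split /=; apply: ler_prod => x _.
rewrite !min_l ?(ltW q1) // inE.
case xS: (x \in S); last by rewrite orbF mul1r; case: ifP => _; lra.
by rewrite (disjointFr SW xS) /=; apply/andP; split; nra.
Qed.

(* The members of F that no fragment S' :\: W with S' in F shortens. *)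
Definition stuck (l : nat) F W := [set S in F | [&& #|S| == l, [disjoint S & W] &
  [forall S' in F, (S' \subset W :|: S) ==> (S' == S)]]].

(** A stuck [S] is the only member of [F] inside [Z = W :|: S], so each [Z] comes from at most one
    pair. Passing from [W] to [Z] costs a factor [q ^- l], which turns [p ^+ l] into
    [(p / q) ^+ l]. *)
Lemma expected_cost_stuck l F q : 0 < q < 1 ->
  \sum_W random_subset_mass q W * cost (stuck l F W) <= (p / q) ^+ l.
Proof.
move=> /andP[q0 q1].
pose uniq_in (Z S : {set T}) := (S \in F) && [forall S' in F, (S' \subset Z) ==> (S' == S)]
  && (S \subset Z).
rewrite -[leRHS]mul1r -(@sum_mass _ T q) big_distrl /=.
have pq : 0 <= (p / q) ^+ l by rewrite exprn_ge0 // divr_ge0 // ltW.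
have qp : 0 < q ^+ l by rewrite exprn_gt0.
apply: (@le_trans _ _ (\sum_W \sum_(S in stuck l F W)
    random_subset_mass q (W :|: S) * (p / q) ^+ l)).
  apply: ler_sum => W _; rewrite big_distrr /=; apply: ler_sum => S.
  rewrite inE => /and4P[SF /eqP Sl SW _].
  rewrite expr_div_n Sl mulrA [leRHS]mulrAC mulrC [leRHS]mulrC.
  rewrite ler_wpM2l ?exprn_ge0 ?(ltW p0) // ler_pdivlMr // mulrC -Sl.
  by apply: mass_add => //; rewrite q0.
apply: (@le_trans _ _ (\sum_S \sum_(Z | uniq_in Z S)
    random_subset_mass q Z * (p / q) ^+ l)); last first.
  rewrite (exchange_big_dep xpredT) //=; apply: ler_sum => Z _.
  have m0 : 0 <= random_subset_mass q Z * (p / q) ^+ l.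
    by rewrite mulr_ge0 // mass_ge0 // ltW.
  case: (pickP (uniq_in Z)) => [S0 S0Z|none]; last by rewrite big_pred0.
  rewrite (big_pred1 S0) // => S; apply/idP/eqP => [SZ|-> //].
  move/andP: S0Z => [/andP[S0F /forallP/(_ S)]].
  by case/andP: SZ => /andP[-> _] -> /= /eqP ->.
rewrite (exchange_big_dep xpredT) //=; apply: ler_sum => S _.
apply: (@ler_sum_inj _ _ _ _ _ (fun W => W :|: S)
  (fun Z => random_subset_mass q Z * (p / q) ^+ l)).
- have WE W : S \in stuck l F W -> (W :|: S) :\: S = W.
    rewrite inE => /and4P[_ _ SW _]; rewrite setDUl setDv setU0.
    by apply/setDidPl; rewrite disjoint_sym.
  by move=> W W' /WE {2}<- /WE {2}<- ->.
- by move=> W; rewrite inE /uniq_in => /and4P[-> _ _ ->]; rewrite subsetUr.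
- by move=> Z; rewrite mulr_ge0 // mass_ge0 // ltW.
Qed.

(** If [S] avoids [W], has [l.+1] points and is not stuck, another member [S'] lies in [W :|: S].
    Were [S' :\: W] to have more than [l] points, [S'] would avoid [W], lie in [S] and equal it by
    size. *)
Lemma stuck_shorten l F W S : (forall S, S \in F -> (#|S| <= l.+1)%N) -> S \in F ->
  S \in stuck l.+1 F W \/
  exists2 S', S' \in [set S' :\: W | S' in F & (#|S' :\: W| <= l)%N] & S' \subset S.
Proof.
move=> Fl SF.
have short S' : S' \in F -> S' \subset W :|: S -> (#|S' :\: W| <= l)%N ->
    exists2 S', S' \in [set S' :\: W | S' in F & (#|S' :\: W| <= l)%N] & S' \subset S.
  move=> S'F S'S S'l; exists (S' :\: W); last by rewrite subDset.
  by apply/imsetP; exists S' => //; rewrite inE S'F.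
have [SWl|lSW] := leqP #|S :\: W| l; first by right; apply: (short S); rewrite ?subsetUr.
have SWE : S :\: W = S.
  apply/eqP; rewrite eqEcard subsetDl /=; exact: leq_trans (Fl _ SF) lSW.
have Sl : #|S| = l.+1 by apply/eqP; rewrite SWE in lSW; rewrite eqn_leq lSW andbT; exact: Fl.
case: (boolP [forall S' in F, (S' \subset W :|: S) ==> (S' == S)]) => [all|].
  by left; rewrite inE SF Sl eqxx all andbT /=; apply/setDidPl.
rewrite negb_forall => /existsP[S']; rewrite !negb_imply => /and3P[S'F S'S nS'].
right; apply: (short S') => //; rewrite leqNgt; apply/negP => lS'.
have S'W : S' :\: W = S'.
  apply/eqP; rewrite eqEcard subsetDl /=; exact: leq_trans (Fl _ S'F) lS'.
move: nS'; rewrite eqEcard -{1}S'W subDset S'S /= Sl.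
by rewrite -S'W lS'.
Qed.

(** Induction on the rounds: with probability at least 3/4 the stuck sets cost at most [d] and the
    family shortens to size [l]; otherwise it is kept. The bound solves this recursion, as
    [4 ^+ l.+1 / 4 + 4 ^+ l] is half of [4 ^+ l.+1]. *)
Lemma hits_rounds q l m F : q = 32 * p -> m%:R * q < 1 ->
  (forall S, S \in F -> (#|S| <= l)%N) -> cover_free ((1 - 2 ^- l) / 4) F ->
  random_subset_prob (m%:R * q) (fun W => ~~ hits F W) <= 4 ^+ l * 2 ^- m.
Proof.
move=> qE; have q0 : 0 < q by rewrite qE mulr_gt0.
elim: m l F => [|m IHm] l F mq Fl Ff.
  rewrite mul0r expr0 invr1 mulr1; apply: le_trans (prob_le1 _ _) _ => //.
  by rewrite exprn_ege1 //; lra.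
case: l Fl Ff => [|l] Fl Ff.
  (* At [l = 0] the threshold is 0, which still forces [F] to have a member, necessarily the empty
     set. *)
  rewrite expr0 invr1 subrr mul0r in Ff.
  have [S SF] := cover_free_neq0 (lexx 0) Ff.
  rewrite /random_subset_prob big_pred0 ?mul1r ?invr_ge0 ?exprn_ge0 // => W.
  apply/negbTE; rewrite negbK; apply/existsP; exists S; rewrite SF.
  by move: (Fl _ SF); rewrite leqn0 cards_eq0 => /eqP ->; rewrite sub0set.
have m0 : 0 <= m%:R * q by rewrite mulr_ge0 // ltW.
rewrite -natr1 mulrDl mul1r addrC in mq *.
have q1 : q < 1 by lra.
apply: le_trans (prob_sprinkle (ltW q0) m0 (ltW mq) _) _.
  by move=> W W' WW'; apply: contra; exact: hitsS.
have mq1 : m%:R * q < 1 by lra.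
have pl : 0 < 2 ^- l :> R by rewrite invr_gt0 exprn_gt0.
(* The gap between the thresholds for [l.+1] and for [l]. *)
pose d : R := 2 ^- l / 8; have d0 : 0 < d by rewrite /d; lra.
have good A : cost (stuck l.+1 F A) <= d ->
    random_subset_prob (m%:R * q) (fun B => ~~ hits F (A :|: B)) <= 4 ^+ l * 2 ^- m.
  move=> Ad; pose F' := [set S' :\: A | S' in F & (#|S' :\: A| <= l)%N].
  apply: (@le_trans _ _ (random_subset_prob (m%:R * q) (fun B => ~~ hits F' B))).
    apply: le_prob => // B; apply: contra.
    case/existsP=> S' /andP[/imsetP[S]]; rewrite inE => /andP[SF _] -> SB.
    by apply/existsP; exists S; rewrite SF -subDset.
  apply: IHm => //.
    by move=> S' /imsetP[S]; rewrite inE => /andP[_ Sl] ->.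
  have -> : (1 - 2 ^- l) / 4 = (1 - 2 ^- l.+1) / 4 - d :> R.
    rewrite /d exprS invfM; field; exact/lt0r_neq0/exprn_gt0.
  apply: cover_free_sub Ff Ad _ => S SF.
  case: (stuck_shorten A Fl SF) => [St|]; [left; exists S => //|by right].
have bad : \sum_(A | d < cost (stuck l.+1 F A)) random_subset_mass q A <= 1 / 4.
  apply: le_trans (sum_markov d0 _ _) _.
  - by move=> A; rewrite mass_ge0 // ltW.
  - by move=> A; exact: cost_ge0.
  rewrite mulrC ler_pdivrMr //.
  apply: le_trans (expected_cost_stuck _ _ _) _.
    by rewrite q0.
  (* The powers of [2^-1] absorb the decay of [d] in [l], and one factor [16^-1] leaves
     [4 / 16 = 1 / 4]. *)
  have -> : p / q = 2^-1 * 16^-1 by rewrite qE; field; exact: lt0r_neq0.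
  rewrite exprMn exprS exprVn /d.
  have : (16^-1 : R) ^+ l.+1 <= 16^-1.
    by rewrite exprS ler_piMr ?invr_ge0 // exprn_ile1 ?invr_ge0 // invf_le1 //; lra.
  nra.
rewrite (bigID (fun A => d < cost (stuck l.+1 F A))) /=.
have X0 : 0 < 4 ^+ l * 2 ^- m :> R.
  by rewrite mulr_gt0 ?exprn_gt0 // invr_gt0 exprn_gt0.
have -> : 4 ^+ l.+1 * 2 ^- m.+1 = 1 / 4 * (4 ^+ l.+1 * 2 ^- m) + 4 ^+ l * 2 ^- m :> R.
  by rewrite !exprS invfM; field; exact/lt0r_neq0/exprn_gt0.
apply: lerD.
  apply: le_trans (_ : (\sum_(A | d < cost (stuck l.+1 F A)) random_subset_mass q A)
     * (4 ^+ l.+1 * 2 ^- m) <= _); last first.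
    by apply: ler_wpM2r bad; rewrite mulr_ge0 ?exprn_ge0 // invr_ge0 exprn_ge0.
  rewrite big_distrl /=; apply: ler_sum => A _.
  apply: ler_wpM2l; first by rewrite mass_ge0 // ltW.
  apply: le_trans (IHm l.+1 F mq1 Fl Ff); apply: le_prob => // B.
  by apply: contra; apply: hitsS; exact: subsetUr.
apply: (@le_trans _ _ (\sum_(A : {set T}) random_subset_mass q A * (4 ^+ l * 2 ^- m))).
  rewrite big_mkcond; apply: ler_sum => A _.
  have mA : 0 <= random_subset_mass q A by rewrite mass_ge0 // ltW.
  case: ifPn => [|_]; last by rewrite mulr_ge0 // ltW.
  by rewrite -leNgt => /good; apply: ler_wpM2l.
by rewrite -big_distrl /= sum_mass mul1r.
Qed.
End BoundedFamilies.

(** * Fragments *)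

Section Fragments.
Local Open Scope nat_scope.
Variables (T : finType) (HH : {set {set T}}) (blk : {set T} -> T -> nat) (a N : nat).

(* A labelling w records for each point the first of the N rounds in which it is
   exposed, the label N meaning never. A labelling t also encodes a fragment, split
   according to the rounds in which its points are to be added: N means outside. *)
Definition labelling := {ffun T -> 'I_N.+1}.
Implicit Types (w t Z : labelling) (S U : {set T}) (e r : nat).

Definition supp t := [set x | t x < N].
Definition minl w t : labelling := [ffun x => if w x <= t x then w x else t x].
Definition cnt t r := #|[set x | t x <= r]|.
(* At scale e, fragments have about 2 ^ e points. A block b of size about
   2 ^ (b.+1 * a) should be contained in the first class_at + 1 rounds (plus the
   fragment); from class N on it is considered finished. *)
Definition class_at e S x := (blk S x).+1 * a - e.
Definition high S b Z r := [set x in S | (blk S x == b) && (r < Z x)].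

(* In earlier classes r only few points of a block may have been left over, and the
   allowance decreases with n r, the number of fragment points of label at most r. *)
Definition witness e Z (n : nat -> nat) S := [&& S \in HH,
  [forall x in S, (class_at e S x < N) ==> (Z x <= class_at e S x)] &
  [forall y in S, forall r : 'I_N, (r < class_at e S y) ==>
     (#|high S (blk S y) Z r| + n r < 2 ^ ((blk S y).+1 * a - r))]].

Definition state e w t := [exists S, witness e (minl w t) (cnt t) S].

(** Requiring every witness to contain each fragment point with its exact class lets any witness
    serve for decoding; [t x < w x] makes [minl w t] agree with [t] on the fragment. *)
Definition good e w t := state e w t &&
  [forall S, witness e (minl w t) (cnt t) S ==>
     [forall x in supp t, [&& x \in S, class_at e S x == t x & t x < w x]]].

Lemma witnessP e Z n S : reflect
  [/\ S \in HH, (forall x, x \in S -> class_at e S x < N -> Z x <= class_at e S x) &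
    (forall y r, y \in S -> r < N -> r < class_at e S y ->
       #|high S (blk S y) Z r| + n r < 2 ^ ((blk S y).+1 * a - r))]
  (witness e Z n S).
Proof.
apply: (iffP and3P) => -[SH H1 H2]; split=> //.
- by move=> x xS; move/forall_inP: H1 => /(_ x xS)/implyP.
- move=> y r yS rN; move/forall_inP: H2 => /(_ y yS)/forallP/(_ (Ordinal rN)).
  by move/implyP.
- by apply/forall_inP => x xS; apply/implyP; exact: H1.
- apply/forall_inP => y yS; apply/forallP => r; apply/implyP; exact: H2.
Qed.

Lemma eq_witness e Z n n' S : (forall r, r < N -> n r = n' r) ->
  witness e Z n S -> witness e Z n' S.
Proof.
move=> nn' /witnessP[SH H1 H2]; apply/witnessP; split=> // y r yS rN ry.
by rewrite -nn' //; exact: H2.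
Qed.

Lemma minlE w t x : minl w t x = minn (w x) (t x) :> nat.
Proof. by rewrite ffunE; case: ifP => /=; lia. Qed.

Lemma cnt_le_supp t r : r < N -> cnt t r <= #|supp t|.
Proof. by move=> rN; apply/subset_leq_card/subsetP => x; rewrite !inE; lia. Qed.

(** Passing from [e.+1] to [e] raises each class by at most one. At the single new level the block
    is already fully exposed, so nothing is high, and the allowance [2 ^ e.+1] exceeds the size of
    the fragment. *)
Lemma stage_down e w t S : witness e.+1 (minl w t) (cnt t) S ->
  #|supp t| < 2 ^ e.+1 -> witness e (minl w t) (cnt t) S.
Proof.
move=> /witnessP[SH H1 H2] te; apply/witnessP; split=> //.
  move=> x xS clN; have le_cl : class_at e.+1 S x <= class_at e S x by rewrite /class_at; lia.
  by apply: (leq_trans (H1 x xS _) le_cl); exact: leq_ltn_trans le_cl clN.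
move=> y r yS rN ry; have [ry'|yr] := ltnP r (class_at e.+1 S y); first exact: H2.
have -> : (blk S y).+1 * a - r = e.+1 by move: ry yr; rewrite /class_at; lia.
have -> : high S (blk S y) (minl w t) r = set0.
  apply/setP => x; rewrite !inE; apply/and3P => -[xS /eqP xy].
  have clr : class_at e.+1 S x = r by move: ry yr; rewrite /class_at xy; lia.
  by have := H1 x xS; rewrite clr => /(_ rN); lia.
by rewrite cards0; apply: leq_ltn_trans te; exact: cnt_le_supp.
Qed.

Definition raise x (v : 'I_N.+1) t : labelling := [ffun y => if y == x then v else t y].

(* Raising t x deletes x from the sets counted by cnt for t x <= r < v, which pays
   for the possible appearance of x in high at the same levels r. *)
Lemma witness_raise e w t S x (v : 'I_N.+1) : t x < v ->
  witness e (minl w t) (cnt t) S ->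
  (x \in S -> class_at e S x < N -> minn (w x) v <= class_at e S x) ->
  witness e (minl w (raise x v t)) (cnt (raise x v t)) S.
Proof.
move=> xv /witnessP[SH H1 H2] Hx; apply/witnessP; split=> //.
  move=> y yS cly; rewrite minlE ffunE; case: eqVneq => [yx|_].
    by move: yS cly; rewrite yx; exact: Hx.
  by rewrite -minlE; exact: H1.
move=> y r yS rN ry; apply: leq_ltn_trans (H2 y r yS rN ry).
have [xrv|xrv] := boolP (t x <= r < v).
  have -> : cnt t r = (cnt (raise x v t) r).+1.
    rewrite /cnt (cardsD1 x) inE (_ : t x <= r = true) ?add1n; last by lia.
    congr (_.+1); apply: eq_card => z; rewrite !inE ffunE.
    by case: eqVneq => //= _; lia.
  rewrite addnS -addSn leq_add2r.
  apply: leq_trans (_ : #|x |: high S (blk S y) (minl w t) r| <= _); last first.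
    by rewrite cardsU1; case: (_ \notin _).
  apply/subset_leq_card/subsetP => z; rewrite !inE !minlE ffunE.
  by case: (z == x) => //=.
apply: leq_add; apply/subset_leq_card/subsetP => z.
  rewrite !inE !minlE ffunE; case: (eqVneq z x) => // ->.
  by move=> /and3P[-> -> rz] /=; lia.
by rewrite !inE ffunE; case: eqVneq => // ->; lia.
Qed.

(* A fragment maximizing the sum of its labels has the property required by good for
   every witness, so that it can be recovered from minl w t and any witness. *)
Lemma exists_good e w t S0 : supp t \subset S0 -> state e w t ->
  exists t', supp t' \subset S0 /\ good e w t'.
Proof.
move=> tS0 st.
pose P t := (supp t \subset S0) && state e w t.
have Pt : P t by rewrite /P tS0.
have [t' [t'S0 st' maxt']] : exists t' : labelling, [/\ supp t' \subset S0,
    state e w t' & forall t1, P t1 -> \sum_x t1 x <= \sum_x t' x].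
  case: (@arg_maxnP _ t P (fun t1 => \sum_x t1 x) Pt) => t' /andP[t'S0 st'] maxt'.
  by exists t'.
exists t'; split=> //; rewrite /good st' /=.
apply/forallP => S; apply/implyP => wS; apply/forall_inP => x.
rewrite inE => xN.
have noraise (v : 'I_N.+1) : t' x < v ->
    ~ (x \in S -> class_at e S x < N -> minn (w x) v <= class_at e S x).
  move=> xv Hv; have Praise : P (raise x v t').
    apply/andP; split; last by apply/existsP; exists S; exact: witness_raise.
    apply: subset_trans t'S0; apply/subsetP => y; rewrite !inE ffunE.
    by case: eqVneq => [->|].
  have := maxt' _ Praise; apply/negP; rewrite -ltnNge.
  rewrite [X in X < _](bigD1 x) // [X in _ < X](bigD1 x) //= ffunE eqxx.
  rewrite -addSn; apply: leq_add => //.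
  by apply/eq_leq/eq_bigr => y /negbTE; rewrite ffunE => ->.
have xS : x \in S by apply/negPn/negP => xS; apply: (noraise ord_max) => //; rewrite (negbTE xS).
have clN : class_at e S x < N.
  by rewrite ltnNge; apply/negP => clN; apply: (noraise ord_max) => //; lia.
have clK : (inord (class_at e S x) : 'I_N.+1) = class_at e S x :> nat.
  by rewrite inordK // ltnS ltnW.
have := noraise (inord (class_at e S x)); rewrite clK => Hcl.
have Zx : minn (w x) (t' x) <= class_at e S x.
  by case/witnessP: wS => _ /(_ x xS clN); rewrite minlE.
have Hmax := noraise ord_max xN.
rewrite xS /=; apply/andP; split; first last.
  rewrite ltnNge; apply/negP => wt; apply: Hmax => _ _ /=. lia.
have [tcl|] := ltnP (t' x) (class_at e S x); first by case: (Hcl tcl) => _ _; lia.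
rewrite leq_eqVlt => /orP[/eqP -> //|clt].
by case: Hmax => _ _ /=; lia.
Qed.

(** The scale goes down from [e0 + k]: an extremal fragment at the current scale is either large, or
    small enough for [stage_down] to lower the scale. *)
Lemma descent k e0 w S0 : 0 < N -> S0 \in HH -> #|T| < 2 ^ (e0 + k).+1 ->
  (exists e t, [/\ e0 < e <= e0 + k, good e w t, supp t \subset S0 & 2 ^ e <= #|supp t|])
  \/ exists t, [/\ state e0 w t, supp t \subset S0 & #|supp t| < 2 ^ e0.+1].
Proof.
move=> N0 S0H; elim: k e0 => [|k IHk] e0 Te.
  right; rewrite addn0 in Te.
  (* At the top scale all of [S0] is added in the first round: nothing is missed and every allowance
     exceeds [#|T|]. *)
  pose t : labelling := [ffun x => if x \in S0 then ord0 else ord_max].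
  have tS : supp t = S0.
    by apply/setP => x; rewrite inE ffunE; case: ifP => //=; rewrite ltnn.
  exists t; rewrite tS; split=> //; last exact: leq_ltn_trans (max_card _) Te.
  apply/existsP; exists S0; apply/witnessP; split=> //.
    by move=> x xS _; rewrite minlE ffunE xS /= minn0.
  move=> y r yS rN ry; rewrite (_ : high _ _ _ _ = set0); last first.
    by apply/setP => x; rewrite !inE minlE ffunE; case: (x \in S0) => //=; rewrite minn0 andbF.
  rewrite cards0 add0n; apply: leq_ltn_trans (max_card _) _; apply: leq_trans Te _.
  by rewrite leq_exp2l //; move: ry; rewrite /class_at; lia.
rewrite addnS -addSn in Te *; case: (IHk e0.+1 Te) => [[e [t [/andP[e0e ek] gt tS te]]]|].
  by left; exists e, t; split=> //; rewrite ek andbT ltnW.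
case=> t [/existsP[S wS] tS te].
have [t' [t'S gt']] : exists t', supp t' \subset S0 /\ good e0.+1 w t'.
  by apply: exists_good tS _; apply/existsP; exists S.
have [big|small] := leqP (2 ^ e0.+1) #|supp t'|.
  by left; exists e0.+1, t'; split=> //; lia.
right; exists t'; split=> //; case/andP: gt' => /existsP[S' wS'] _.
by apply/existsP; exists S'; exact: stage_down.
Qed.

End Fragments.

(** * Counting fragments *)

Section Counting.
Local Open Scope nat_scope.
Variables (T : finType) (HH : {set {set T}}) (blk : {set T} -> T -> nat) (a N : nat).
Hypotheses (a0 : 0 < a) (NE : N = 2 * a).
Hypothesis blk_size : forall S e, S \in HH ->
  #|[set x in S | (blk S x).+1 * a <= e]| <= 2 ^ e.
Notation labelling := (labelling T N).
Implicit Types (w t Z : labelling) (S U : {set T}) (e r : nat).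
Notation witness := (witness HH blk a).
Notation cl := (class_at blk a).

Definition candidates e Z S := [set x in S | (cl e S x < N) && (Z x == cl e S x :> nat)].

Definition restrict Z U : labelling := [ffun x => if x \in U then Z x else ord_max].

Definition decodable e Z U :=
  [exists S, witness e Z (cnt (restrict Z U)) S] &&
  [forall S, witness e Z (cnt (restrict Z U)) S ==> (U \subset candidates e Z S)].

(** With [cl2], the only positive classes below [N] that occur at scale [e]. *)
Definition cl1 e := (e %/ a).+1 * a - e.
Definition cl2 e := (e %/ a).+2 * a - e.

Lemma cl12 e : 0 < cl1 e < cl2 e.
Proof.
rewrite /cl1 /cl2 {2 4}(divn_eq e a) !mulSn.
have := ltn_pmod e a0; lia.
Qed.

(** The number [(blk S x).+1 * a] lies strictly between [e] and [e + 2 * a], an interval with at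
    most two multiples of [a]. *)
Lemma active_blocks e S x : cl e S x < N -> 0 < cl e S x ->
  blk S x = e %/ a \/ blk S x = (e %/ a).+1.
Proof.
rewrite /class_at NE; set b := blk S x => lt0 gt0.
have := divn_eq e a; have := ltn_pmod e a0.
set k := e %/ a; set m := e %% a => ma eE.
have kb : k < b.+1 by rewrite -(ltn_pmul2r a0); lia.
have bk : b.+1 < k.+3 by rewrite -(ltn_pmul2r a0) !mulSn; lia.
lia.
Qed.

Lemma candidates_cl e Z S x : x \in candidates e Z S ->
  [|| Z x == 0 :> nat, Z x == cl1 e :> nat | Z x == cl2 e :> nat].
Proof.
rewrite inE => /and3P[xS clN /eqP ->].
have [->//|] := eqVneq (cl e S x) 0; rewrite -lt0n => cl0 /=.
by case: (active_blocks clN cl0) => bE; rewrite /class_at bE /cl1 /cl2 eqxx ?orbT.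
Qed.

(** Class 0 contributes at most [2 ^ e] points by [blk_size]. In each of the two active blocks the
    candidates are still high one level below their class, where the allowance is [2 ^ e.+1]. *)
Lemma card_candidates e Z n S : witness e Z n S -> #|candidates e Z S| <= 5 * 2 ^ e.
Proof.
move=> /witnessP[SH _ H2].
pose A b := [set x in candidates e Z S | (0 < cl e S x) && (blk S x == b)].
have cA b : #|A b| <= 2 ^ e.+1.
  case: (set_0Vmem (A b)) => [->|[y]]; first by rewrite cards0.
  rewrite 2!inE => /and3P[/and3P[yS clN _] cl0 /eqP yb].
  have := H2 y (cl e S y).-1 yS; move=> /(_ _ _)/ltnW; rewrite yb => H.
  have -> : e.+1 = b.+1 * a - (cl e S y).-1 by rewrite -yb; move: cl0; rewrite /class_at; lia.
  apply: leq_trans (H _ _); [|by lia|by lia].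
  apply: leq_trans (leq_addr _ _); apply/subset_leq_card/subsetP => x.
  rewrite 3!inE => /and3P[/and3P[-> _ /eqP ->] _ /eqP xb].
  by rewrite xb eqxx /=; move: cl0; rewrite /class_at yb xb; lia.
pose A0 := [set x in S | (blk S x).+1 * a <= e].
have sub : candidates e Z S \subset A0 :|: (A (e %/ a) :|: A (e %/ a).+1).
  apply/subsetP => x xD; have := xD; rewrite 3!inE => /and3P[xS clN _].
  have [cl0|] := posnP (cl e S x).
    by rewrite inE inE xS; move: cl0; rewrite /class_at => /eqP; rewrite subn_eq0 => ->.
  move=> cl0; case: (active_blocks clN cl0) => bE.
    by rewrite !in_setU [x \in A (e %/ a)]inE xD cl0 bE eqxx /= orbT.
  by rewrite !in_setU [x \in A (e %/ a).+1]inE xD cl0 bE eqxx /= !orbT.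
apply: leq_trans (subset_leq_card sub) _.
have := leq_card_setU A0 (A (e %/ a) :|: A (e %/ a).+1).
have := leq_card_setU (A (e %/ a)) (A (e %/ a).+1).
have := blk_size e SH; have := cA (e %/ a); have := cA (e %/ a).+1.
rewrite expnS -/A0 /= => h1 h2 h3 [h4 _] [h5 _]; lia.
Qed.

Definition count_of e u (v : 'I_u.+1 * 'I_u.+1 * 'I_u.+1) r :=
  v.1.1 + (cl1 e <= r) * v.1.2 + (cl2 e <= r) * v.2.

(** All labels on [U] are 0, [cl1 e] or [cl2 e], so three sizes determine the counts. This keeps the
    number of possible count functions small. *)
Lemma code_count e Z U : decodable e Z U ->
  exists v : 'I_#|U|.+1 * 'I_#|U|.+1 * 'I_#|U|.+1,
  forall r, r < N -> cnt (restrict Z U) r = count_of e v r.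
Proof.
move=> /andP[/existsP[S wS] /forallP/(_ S)]; rewrite wS => /subsetP UD.
pose V c := [set x in U | Z x == c :> nat].
have VU c : #|V c| < #|U|.+1.
  by rewrite ltnS; apply/subset_leq_card/subsetP => x; rewrite inE => /andP[].
exists (Ordinal (VU 0), Ordinal (VU (cl1 e)), Ordinal (VU (cl2 e))) => r rN.
have cardE (P : pred T) : #|[set x in U | P x]| = \sum_(x in U) P x.
  by rewrite -sum1dep_card big_mkcondr; apply: eq_bigr => x _; case: (P x).
rewrite /count_of /= /V !cardE !big_distrr -!big_split /=.
transitivity #|[set x in U | Z x <= r]|.
  apply: eq_card => x; rewrite !inE ffunE; case: (x \in U) => //=.
  by rewrite leqNgt rN.
rewrite cardE; apply: eq_bigr => x /UD/candidates_cl.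
by have := cl12 e; lia.
Qed.

Lemma card_bigcup_le (I J : finType) (F : I -> {set J}) k :
  (forall i, #|F i| <= k) -> #|\bigcup_i F i| <= #|I| * k.
Proof.
move=> Fk; rewrite -sum_nat_const.
elim/big_ind2: _ => [|m A m' B Am Bm'|i _]; rewrite ?cards0 ?Fk //.
by apply: leq_trans (leq_add Am Bm'); case: (leq_card_setU A B).
Qed.

(* Once the three sizes in count_of are fixed, one witness S is valid for all U, and
   U is a subset of its candidates. *)
Lemma card_codes e Z u : 2 ^ e <= u ->
  #|[set U : {set T} | (#|U| == u) && decodable e Z U]| <= 256 ^ u.
Proof.
move=> eu; pose I := ('I_u.+1 * 'I_u.+1 * 'I_u.+1)%type.
pose D (v : I) := if [pick S | witness e Z (count_of e v) S] is Some S0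
  then powerset (candidates e Z S0) else [set set0].
have cD v : #|D v| <= 2 ^ (5 * u).
  rewrite /D; case: pickP => [S wS|_]; last by rewrite cards1 expn_gt0.
  rewrite card_powerset leq_exp2l //; apply: leq_trans (card_candidates wS) _.
  by rewrite leq_mul2l.
have sub : [set U : {set T} | (#|U| == u) && decodable e Z U] \subset \bigcup_v D v.
  apply/subsetP => U; rewrite inE => /andP[/eqP uU cU].
  have [] := code_count cU; rewrite uU => v vE; apply/bigcupP; exists v => //.
  case/andP: cU => /existsP[S wS] /forallP UD; rewrite /D.
  case: pickP => [S' wS'|/(_ S)]; last by rewrite (eq_witness vE wS).
  rewrite powersetE; move: (UD S'); rewrite (eq_witness _ wS') // => r rN.
  by rewrite vE.
apply: leq_trans (subset_leq_card sub) _; apply: leq_trans (card_bigcup_le cD) _.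
(* There are [u.+1 ^ 3 <= 2 ^ (3 * u)] triples of sizes, with at most [2 ^ (5 * u)] sets of
   candidates each. *)
rewrite !card_prod card_ord (_ : 256 = 2 ^ 3 * 2 ^ 5) // expnMn -!expnM leq_mul2r.
apply/orP; right; rewrite (_ : 2 ^ (3 * u) = 2 ^ u * 2 ^ u * 2 ^ u).
  by rewrite !leq_mul // ltn_expl.
by rewrite -!expnD; congr (2 ^ _); lia.
Qed.
End Counting.

(** * Expected cost of large fragments *)

Section ExpectedCost.
Variables (R : realType) (T : finType) (HH : {set {set T}}).
Variables (blk : {set T} -> T -> nat) (a N : nat) (p q : R).
Hypotheses (a0 : (0 < a)%N) (NE : (N = 2 * a)%N).
Hypothesis blk_size : forall S e, S \in HH ->
  (#|[set x in S | (blk S x).+1 * a <= e]| <= 2 ^ e)%N.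
Hypotheses (p0 : 0 < p) (q0 : 0 < q) (Nq1 : N%:R * q <= 1).
Notation labelling := (labelling T N).
Implicit Types (w t Z : labelling) (S U : {set T}) (e r : nat).

(** Recording only the first exposure makes the rounds disjoint, so together they have density
    exactly [N * q]. *)
Definition label_weight (v : 'I_N.+1) : R := if (v < N)%N then q else 1 - N%:R * q.

Definition label_mass w : R := \prod_x label_weight (w x).

Lemma label_weight_ge0 v : 0 <= label_weight v.
Proof. by rewrite /label_weight; case: ifP => _; [exact: ltW | rewrite subr_ge0]. Qed.

Lemma label_mass_ge0 w : 0 <= label_mass w.
Proof. by apply: prodr_ge0 => x _; exact: label_weight_ge0. Qed.

Lemma sum_label_weight_lt : \sum_(v : 'I_N.+1 | (v < N)%N) label_weight v = N%:R * q.
Proof.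
rewrite big_mkcond big_ord_recr /= ltnn addr0.
under eq_bigr => i _ do rewrite /label_weight /= ltn_ord.
by rewrite sumr_const card_ord mulr_natl.
Qed.

Lemma sum_label_weight_ge :
  \sum_(v : 'I_N.+1 | ~~ (v < N)%N) label_weight v = 1 - N%:R * q.
Proof.
rewrite big_mkcond big_ord_recr /= ltnn /= /label_weight /= ltnn.
by rewrite big1 ?add0r // => i _; rewrite ltn_ord.
Qed.

Lemma sum_label_weight : \sum_v label_weight v = 1.
Proof.
by rewrite (bigID (fun v : 'I_N.+1 => (v < N)%N)) /= sum_label_weight_lt
  sum_label_weight_ge; ring.
Qed.

Lemma sum_label_mass : \sum_w label_mass w = 1.
Proof.
rewrite -(bigA_distr_bigA (fun (_ : T) v => label_weight v)) big1 // => x _.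
exact: sum_label_weight.
Qed.

Lemma sum_label_mass_covered (F : {set T} -> R) :
  \sum_w label_mass w * F [set x | (w x < N)%N] =
  \sum_W random_subset_mass (N%:R * q) W * F W.
Proof.
have := sum_prod_ffun_push label_weight (fun v : 'I_N.+1 => (v < N)%N) F.
rewrite sum_label_weight_lt sum_label_weight_ge => ->.
by apply: eq_bigr => W _; rewrite /random_subset_mass min_l.
Qed.

Definition below w t := [forall x in supp t, (t x < w x)%N].
Definition agree Z t := [forall x in supp t, Z x == t x].

(** Change of measure: given [Z = minl w t], the labelling [w] equals [Z] off [supp t], and on
    [supp t] its total weight is at most 1, whereas each factor of [Z] there is [q]. *)
Lemma sum_label_mass_minl t (g : labelling -> R) : (forall Z, 0 <= g Z) ->
  \sum_(w | below w t) label_mass w * g (minl w t) <=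
  \sum_(Z | agree Z t) label_mass Z * (g Z / q ^+ #|supp t|).
Proof.
move=> g0; rewrite (partition_big (fun w => minl w t) (fun Z => agree Z t)) /=; last first.
  move=> w /forall_inP wt; apply/forall_inP => x xt.
  by apply/eqP/val_inj; rewrite /= minlE; have := wt x xt; lia.
apply: ler_sum => Z /forall_inP Zt; rewrite mulrA mulrAC.
under eq_bigr => w /andP[_ /eqP wZ] do rewrite wZ.
rewrite -big_distrl /=; apply: ler_wpM2r => //.
pose Q x (v : 'I_N.+1) := (x \in supp t) || (v == Z x).
apply: (@le_trans _ _ (\prod_x \sum_(v | Q x v) label_weight v)).
  rewrite bigA_distr_big_dep /= big_mkcond [leRHS]big_mkcond; apply: ler_sum => w _.
  case: ifPn => [/andP[wt /eqP wZ]|_]; last first.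
    by case: ifP => // _; exact: label_mass_ge0.
  rewrite (_ : w \in _) //; apply/familyP => x; rewrite unfold_in /= /Q.
  have [//|/=] := boolP (x \in supp t); rewrite inE -leqNgt => tx.
  by apply/eqP/val_inj; rewrite -wZ /= minlE; have := ltn_ord (w x); lia.
rewrite -prodr_const ler_pdivlMr ?prodr_gt0 //.
rewrite [X in _ * X <= _]big_mkcond -big_split /=; apply: ler_prod => x _.
rewrite /Q; case: ifP => xt /=.
  rewrite sum_label_weight mul1r ltW //= (eqP (Zt x xt)) /label_weight.
  by move: xt; rewrite inE => ->.
by rewrite mulr1 big_pred1_eq label_weight_ge0 lexx.
Qed.

Notation good := (good HH blk a).
Notation code := (decodable HH blk a).

Lemma restrict_minl w t : below w t -> restrict (minl w t) (supp t) = t.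
Proof.
move=> /forall_inP wt; apply/ffunP => x; rewrite ffunE; apply/val_inj.
case: ifPn => [xt|]; first by rewrite /= minlE; have := wt x xt; lia.
by rewrite inE /=; have := ltn_ord (t x); lia.
Qed.

Lemma good_code e w t : good e w t -> below w t && code e (minl w t) (supp t).
Proof.
case/andP=> /existsP[S wS] /forallP gt.
have wt : below w t.
  have := gt S; rewrite wS => /forall_inP {}gt.
  by apply/forall_inP => x /gt/and3P[].
rewrite wt /= /decodable restrict_minl //; apply/andP; split; first by apply/existsP; exists S.
apply/forallP => S'; apply/implyP => wS'; apply/subsetP => x xt.
have := gt S'; rewrite wS' => /forall_inP/(_ x xt)/and3P[xS /eqP clx wx].
rewrite inE xS clx minlE; move: xt; rewrite inE => -> /=; apply/eqP; lia.
Qed.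

Definition stage_cost e w := \sum_(t | good e w t && (2 ^ e <= #|supp t|)%N) p ^+ #|supp t|.

(** Summing over [Z = minl w t] instead of [w] turns [p] into [p / q]. Given [Z], a fragment is
    determined by its support, and [card_codes] allows at most [256 ^ u] supports of size [u]. *)
Lemma expected_stage_cost e :
  \sum_w label_mass w * stage_cost e w <=
  \sum_(2 ^ e <= u < #|T|.+1) (256 * (p / q)) ^+ u.
Proof.
pose big e U := (2 ^ e <= #|U|)%N.
pose g t Z := if code e Z (supp t) && big e (supp t) then p ^+ #|supp t| else 0.
pose h Z U := if code e Z U && big e U then (p / q) ^+ #|U| else 0.
have pq0 : 0 < p / q by rewrite divr_gt0.
have h0 Z U : 0 <= h Z U by rewrite /h; case: ifP => // _; rewrite exprn_ge0 // ltW.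
apply: (@le_trans _ _ (\sum_w \sum_(t | below w t) label_mass w * g t (minl w t))).
  apply: ler_sum => w _; rewrite big_distrr /= big_mkcond [leRHS]big_mkcond /=.
  apply: ler_sum => t _; rewrite /g; case: ifPn => [/andP[/good_code/andP[-> ->] tb]|_].
    by rewrite /big tb.
  case: ifP => // _; rewrite mulr_ge0 ?label_mass_ge0 //.
  by case: ifP => // _; rewrite exprn_ge0 // ltW.
rewrite (exchange_big_dep xpredT) //=.
apply: (@le_trans _ _ (\sum_t \sum_(Z | agree Z t) label_mass Z * h Z (supp t))).
  apply: ler_sum => t _; apply: le_trans (sum_label_mass_minl _ _) _.
    by move=> Z; rewrite /g; case: ifP => // _; rewrite exprn_ge0 // ltW.
  apply: ler_sum => Z _; rewrite /g /h; case: ifP => _; last by rewrite mul0r.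
  by rewrite expr_div_n.
rewrite (exchange_big_dep xpredT) //= -[leRHS]mul1r -[X in _ <= X * _]sum_label_mass.
rewrite big_distrl /=; apply: ler_sum => Z _; rewrite -big_distrr /=.
apply: ler_wpM2l; first exact: label_mass_ge0.
apply: (@le_trans _ _ (\sum_U h Z U)).
  apply: (@ler_sum_inj _ _ _ _ _ (@supp T N) (h Z)) => //.
  move=> t t' /forall_inP Zt /forall_inP Zt' tt'; apply/ffunP => x.
  have [xt|xt] := boolP (x \in supp t).
    by rewrite -(eqP (Zt x xt)) -(eqP (Zt' x _)) // -tt'.
  have xt' : x \notin supp t' by rewrite -tt'.
  apply/val_inj/eqP; move: xt xt'; rewrite !inE -!leqNgt /= => Nt Nt'.
  by rewrite eqn_leq (leq_trans (leq_ord _) Nt') (leq_trans (leq_ord _) Nt).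
have szU U : (#|U| < #|T|.+1)%N by rewrite ltnS max_card.
rewrite (partition_big (fun U => Ordinal (szU U)) xpredT) //=.
rewrite big_geq_mkord /= [leRHS]big_mkcond /=; apply: ler_sum => u _.
case: ifPn => [eu|nu]; last first.
  rewrite big1 // => U /eqP/(congr1 val)/= Uu; rewrite /h /big Uu.
  by rewrite (negbTE nu) andbF.
apply: (@le_trans _ _ (\sum_(U in [set U : {set T} | (#|U| == u) && code e Z U])
    (p / q) ^+ u)).
  rewrite big_mkcond [leRHS]big_mkcond; apply: ler_sum => U _.
  rewrite inE -val_eqE /=; case: eqP => //= Uu; rewrite /h Uu.
  by case: (code e Z U) => //=; case: ifP => // _; rewrite exprn_ge0 // ltW.
rewrite sumr_const [leRHS]exprMn -[leLHS]mulr_natl ler_wpM2r ?exprn_ge0 ?(ltW pq0) //.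
by rewrite -natrX ler_nat; exact: card_codes eu.
Qed.

End ExpectedCost.

(** * Blocks of decreasing weight *)

Section Blocks.
Variables (R : realType) (T : finType) (lambda : {set T} -> T -> R) (a : nat).
Hypothesis a0 : (0 < a)%N.
Implicit Types (S Y : {set T}).

Definition decreasing_enum S := sort (fun x y => lambda S y <= lambda S x) (enum S).

Definition rank S x := index x (decreasing_enum S).

Definition block S x := (trunc_log 2 (rank S x).+1 %/ a)%N.

Lemma mem_decreasing_enum S x : (x \in decreasing_enum S) = (x \in S).
Proof. by rewrite mem_sort mem_enum. Qed.

Lemma decreasing_enum_uniq S : uniq (decreasing_enum S).
Proof. by rewrite sort_uniq enum_uniq. Qed.

Lemma rank_block S x :
  (2 ^ (block S x * a) <= (rank S x).+1 < 2 ^ ((block S x).+1 * a))%N.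
Proof.
have /andP[lo hi] := trunc_log_bounds (isT : (1 < 2)%N) (ltn0Sn (rank S x)).
apply/andP; split; first by apply: leq_trans lo; rewrite leq_exp2l // leq_trunc_div.
by apply: leq_trans hi _; rewrite leq_exp2l // ltn_ceil.
Qed.

Lemma block_eq S x b : (2 ^ (b * a) <= (rank S x).+1 < 2 ^ (b.+1 * a))%N -> block S x = b.
Proof.
case/andP=> lo hi; have /andP[lo' hi'] := rank_block S x.
have := leq_ltn_trans lo hi'; have := leq_ltn_trans lo' hi.
by rewrite !ltn_exp2l // !ltn_mul2r a0 /= !ltnS => ? ?; apply/eqP; rewrite eqn_leq; apply/andP.
Qed.

Lemma block_size S e : (#|[set x in S | (block S x).+1 * a <= e]| <= 2 ^ e)%N.
Proof.
apply: leq_trans (_ : #|take (2 ^ e) (decreasing_enum S)| <= _)%N; last first.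
  by apply: leq_trans (card_size _) _; rewrite size_take_min geq_minl.
apply/subset_leq_card/subsetP => x; rewrite inE => /andP[xS be].
rewrite in_take ?mem_decreasing_enum //; apply: ltnW.
have /andP[_ hi] := rank_block S x; apply: leq_trans hi _.
by rewrite leq_exp2l.
Qed.

Lemma lambda_block S x y : x \in S -> y \in S -> (block S y < block S x)%N ->
  lambda S x <= lambda S y.
Proof.
move=> xS yS yx; have yx' : (rank S y < rank S x)%N.
  have /andP[_ hi] := rank_block S y; have /andP[lo _] := rank_block S x.
  rewrite -ltnS; apply: leq_trans hi _; apply: leq_trans lo.
  by rewrite leq_exp2l // leq_mul2r yx orbT.
apply: (sorted_ltn_index (leT := fun x y => lambda S y <= lambda S x)) yx'.
- by move=> ? ? ? H1 H2; exact: le_trans H2 H1.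
- by apply: sort_sorted => ? ?; exact: le_total.
- by rewrite mem_decreasing_enum.
- by rewrite mem_decreasing_enum.
Qed.

(** A point in block [b.+1] forces block [b] to be complete, with [2 ^ (b.+1 * a) - 2 ^ (b * a)]
    points; as [0 < a], this is at least half of the first power. *)
Lemma previous_block_size S x b : x \in S -> block S x = b.+1 ->
  (2 ^ (b.+1 * a) <= 2 * #|[set y in S | block S y == b]|)%N.
Proof.
move=> xS xb; set s := decreasing_enum S.
(* Ranks start at 0, so block [b] fills the positions from [k] to [n - 1]. *)
pose k := (2 ^ (b * a)).-1; pose n := (2 ^ (b.+1 * a)).-1.
have kE : k.+1 = (2 ^ (b * a))%N by rewrite prednK ?expn_gt0.
have nE : n.+1 = (2 ^ (b.+1 * a))%N by rewrite prednK ?expn_gt0.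
have kn : (2 * k.+1 <= n.+1)%N.
  by rewrite kE nE -expnS leq_exp2l // mulSn -addn1 addnC leq_add2r.
have ns : (n < size s)%N.
  apply: (@leq_ltn_trans (rank S x)); last by rewrite index_mem mem_decreasing_enum.
  by have /andP[lo _] := rank_block S x; rewrite -ltnS nE -xb.
have un : uniq (take n s) by rewrite take_uniq // decreasing_enum_uniq.
have sub : (#|drop k (take n s)| <= #|[set y in S | block S y == b]|)%N.
  apply/subset_leq_card/subsetP => y yd.
  have yn := mem_drop yd; have ys := mem_take yn.
  rewrite inE -mem_decreasing_enum ys; apply/eqP/block_eq.
  rewrite -kE -nE !ltnS; apply/andP; split; last by rewrite -in_take.
  rewrite leqNgt -in_take //; apply/negP => yk.
  move: un; rewrite -(cat_take_drop k (take n s)) cat_uniq => /and3P[_ /hasPn/(_ y yd)].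
  by rewrite /= take_takel ?yk //; lia.
rewrite (card_uniqP _) ?drop_uniq // size_drop size_takel ?(ltnW ns) // in sub.
by lia.
Qed.

(** A missed point of block [b.+1] is charged to the points of block [b], all at least as heavy, at
    rate [2 / 2 ^+ (b.+1 * a)]. At most [2 * 2 ^ (b * a)] missed points charge a given point, hence
    at most [4 / 2 ^+ a] times its weight. *)
Lemma uncovered_weight S Y : (forall x, x \in S -> 0 <= lambda S x) ->
  (forall y, y \in S :\: Y -> (0 < block S y)%N /\
     (#|[set x in S :\: Y | block S x == block S y]| <= 2 * 2 ^ ((block S y).-1 * a))%N) ->
  \sum_(x in S :\: Y) lambda S x <= 4 / 2 ^+ a * \sum_(x in S) lambda S x.
Proof.
move=> l0 HY; have pw n : 0 < 2 ^+ n :> R by rewrite exprn_gt0.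
have avg x : x \in S :\: Y ->
    lambda S x <= \sum_(y in S | block S x == (block S y).+1)
      2 / 2 ^+ ((block S y).+1 * a) * lambda S y.
  move=> xSY; have [b0 _] := HY x xSY; have xS : x \in S by case/setDP: xSY.
  pose b := (block S x).-1; have xb : block S x = b.+1 by rewrite /b prednK.
  have /(_ b xS xb) := @previous_block_size S x; set B := [set y in S | _] => Bb.
  apply: (@le_trans _ _ (\sum_(y in B) 2 / 2 ^+ (b.+1 * a) * lambda S x)).
    rewrite sumr_const -[leRHS]mulr_natr; have := l0 x xS => lx.
    rewrite mulrAC ler_peMl // mulrAC ler_pdivlMr // mul1r.
    by rewrite -natrX -natrM ler_nat.
  rewrite [leLHS]big_mkcond [leRHS]big_mkcond; apply: ler_sum => y _.
  rewrite inE xb eqSS [b == _]eq_sym; case yS: (y \in S) => //=.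
  case: eqVneq => // yb; rewrite yb.
  apply: ler_wpM2l; first by rewrite divr_ge0 // ltW.
  by apply: lambda_block => //; rewrite xb yb.
apply: le_trans (ler_sum _ avg) _.
rewrite (exchange_big_dep (fun y => y \in S)) /=; last by move=> x y _ /andP[].
rewrite big_distrr /=; apply: ler_sum => y yS.
rewrite sumr_const -[leLHS]mulr_natr mulrAC; apply: ler_wpM2r; first exact: l0.
rewrite mulrAC ler_pdivrMr // mulrAC ler_pdivlMr //.
rewrite -!natrX -!natrM ler_nat.
set c := #|_|; suff : (c <= 2 * 2 ^ (block S y * a))%N.
  by rewrite mulSn expnD; move: (2 ^ a)%N (2 ^ (_ * a))%N => A B; nia.
have [/eqP|c0] := posnP c; first by move=> /eqP ->.
case/card_gt0P: c0 => x; rewrite unfold_in => /andP[xSY /andP[_ /eqP xb]].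
have [_] := HY x xSY; rewrite xb /=; apply: leq_trans.
by apply/subset_leq_card/subsetP => z; rewrite unfold_in => /andP[zS /andP[_ zb]]; rewrite inE zS zb.
Qed.

(** Missed points have class at least [N], which excludes block 0; the allowance at level [N.-1] is
    then the bound that [uncovered_weight] asks for. *)
Lemma witness_weight (HH : {set {set T}}) N e (Z : labelling T N) n S Y : N = (2 * a)%N ->
  witness HH block a e Z n S -> [set x | (Z x < N)%N] \subset Y ->
  (forall x, 0 <= lambda S x) ->
  (1 - 4 / 2 ^+ a) * \sum_(x in S) lambda S x <= \sum_(x in Y :&: S) lambda S x.
Proof.
move=> NE /witnessP[SH H1 H2] /subsetP ZY l0.
have := @uncovered_weight S Y (fun x _ => l0 x).
rewrite [\sum_(x in S) lambda S x](big_setID Y) /= [S :&: Y]setIC => H.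
suff : \sum_(x in S :\: Y) lambda S x <= 4 / 2 ^+ a *
   (\sum_(x in Y :&: S) lambda S x + \sum_(x in S :\: Y) lambda S x) by lra.
apply: H => y /setDP[yS yY].
have Zy x : x \notin Y -> (N <= Z x)%N.
  by move=> xY; rewrite leqNgt; apply: contra xY => xN; apply: ZY; rewrite inE.
have clN : (N <= class_at block a e S y)%N.
  by rewrite leqNgt; apply/negP => /[dup] /(H1 y yS) h ?; have := Zy y yY; lia.
have b0 : (0 < block S y)%N.
  by rewrite lt0n; apply/eqP => b0; move: clN; rewrite /class_at b0 NE; lia.
split=> //; have := H2 y N.-1 yS; move=> /(_ _ _)/ltnW H2'.
have -> : (2 * 2 ^ ((block S y).-1 * a))%N = (2 ^ ((block S y).+1 * a - N.-1))%N.
  rewrite -expnS; congr (2 ^ _)%N; move: b0; case: (block S y) => // b _ /=.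
  by rewrite !mulSn NE; lia.
apply: leq_trans (H2' _ _); [|by lia|by lia].
apply: leq_trans (leq_addr _ _); apply/subset_leq_card/subsetP => x.
rewrite inE => /andP[/setDP[xS xY] xb]; rewrite inE xS xb /=.
by have := Zy x xY; lia.
Qed.

End Blocks.

(** * Combining the two phases *)

Section Assembly.
Variables (R : realType) (T : finType) (p : R).
Hypothesis p0 : 0 < p.

Lemma cost_imset (I : finType) (h : I -> {set T}) (A : {set I}) :
  cost p (h @: A) <= \sum_(i in A) p ^+ #|h i|.
Proof.
rewrite (partition_big_imset h) /=; apply: ler_sum => _ /imsetP[i iA ->].
rewrite (bigD1 i) /=; last by rewrite iA eqxx.
by rewrite lerDl; apply: sumr_ge0 => j _; rewrite exprn_ge0 // ltW.
Qed.

Lemma cost_bigcup (r : seq nat) (G : nat -> {set {set T}}) :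
  cost p (\bigcup_(e <- r) G e) <= \sum_(e <- r) cost p (G e).
Proof.
elim/big_ind2: _ => [|G1 c1 G2 c2 H1 H2|//]; first by rewrite /cost big_set0.
by apply: le_trans (costU p0 _ _) _; exact: lerD.
Qed.

End Assembly.

Lemma geometric_sum_le (R : realFieldType) (x : R) m n : 0 <= x <= 1 / 2 ->
  \sum_(m <= u < n) x ^+ u <= 2 * x ^+ m.
Proof.
move=> /andP[x0 x2]; have [nm|mn] := leqP n m.
  by rewrite big_geq // mulr_ge0 // exprn_ge0.
apply: (@le_trans _ _ (\sum_(m <= u < n) (2 * x ^+ u - 2 * x ^+ u.+1))).
  apply: ler_sum => u _; rewrite exprS.
  by have := exprn_ge0 u x0; nra.
rewrite (telescope_sumr_eq (fun u => - (2 * x ^+ u))) ?(ltnW mn) //.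
  by have := exprn_ge0 n x0; lra.
by move=> u _; ring.
Qed.

Lemma tail_cost (R : realFieldType) s e0 e1 n : (s < 2 ^ e0.+1)%N ->
  \sum_(e0.+1 <= e < e1) \sum_(2 ^ e <= u < n) (2 ^- 6 : R) ^+ u <= 2 ^- (s + 4).
Proof.
(* One factor [8^-1], with [s < 2 ^ e], gives the decay in [s]; the other makes the sum over scales
   converge. *)
move=> se0; have x8 : 2 ^- 6 = 8^-1 * 8^-1 :> R by field.
have le8 k : (s < 2 ^ k)%N -> (8^-1 : R) ^+ (2 ^ k) <= 8^-1 ^+ s.+1.
  by move=> sk; rewrite ler_wiXn2l //; lra.
apply: (@le_trans _ _ (\sum_(e0.+1 <= e < e1) 2 * (8^-1 ^+ s.+1 * 8^-1 ^+ e))).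
  rewrite big_nat_cond [leRHS]big_nat_cond; apply: ler_sum => e /andP[/andP[e0e _] _].
  apply: le_trans (geometric_sum_le _ _ _) _; first by lra.
  rewrite ler_pM2l // x8 exprMn; apply: ler_pM; rewrite ?exprn_ge0 ?invr_ge0 //.
    by apply: le8; apply: leq_trans se0 _; rewrite leq_exp2l.
  by rewrite ler_wiXn2l // ?(ltnW (ltn_expl _ _)) //; lra.
rewrite -!big_distrr /=.
have : \sum_(e0.+1 <= e < e1) (8^-1 : R) ^+ e <= 2 * 8^-1.
  apply: le_trans (geometric_sum_le _ _ _) _; first by lra.
  by rewrite ler_pM2l // exprS ler_piMr ?invr_ge0 // exprn_ile1 //; lra.
set X := \sum_(_ <= _ < _) _ => X8.
have -> : 2 ^- (s + 4) = 2^-1 ^+ s * 16^-1 :> R.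
  by rewrite exprD invfM exprVn; congr (_ * _); field.
have : (8^-1 : R) ^+ s <= 2^-1 ^+ s by rewrite lerXn2r ?nnegrE ?invr_ge0 //; lra.
have s8 : 0 < (8^-1 : R) ^+ s by rewrite exprn_gt0 // invr_gt0.
move=> s82.
rewrite exprS; set Y := _ ^+ s in s8 s82 *; set V := _ ^+ s in s82 *.
nra.
Qed.

Section Reduction.
Variables (R : realType) (T : finType) (HH : {set {set T}}).
Variables (blk : {set T} -> T -> nat) (a N : nat) (p : R).
Hypothesis p0 : 0 < p.
Notation labelling := (labelling T N).

Definition large_fragments e (w : labelling) :=
  [set supp t | t in [set t | good HH blk a e w t && (2 ^ e <= #|supp t|)%N]].

Definition small_fragments e (w : labelling) :=
  [set supp t | t in [set t | state HH blk a e w t && (#|supp t| < 2 ^ e.+1)%N]].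

Definition total_cost e0 (w : labelling) := \sum_(e0.+1 <= e < (e0 + #|T|).+1) stage_cost HH blk a p e w.

(** By [descent] every member of [HH] contains a large or a small fragment. The large ones cost at
    most 1/4, so a cover of the small ones of cost 1/4 would complete one of [HH] of cost 1/2. *)
Lemma small_fragments_cover_free e0 (w : labelling) : (0 < N)%N -> cover_free p (1 / 2) HH ->
  total_cost e0 w <= 1 / 4 -> cover_free p (1 / 4) (small_fragments e0 w).
Proof.
move=> N0 HHf cw; pose r := index_iota e0.+1 (e0 + #|T|).+1.
have -> : 1 / 4 = 1 / 2 - 1 / 4 :> R by field.
apply: (@cover_free_sub _ _ _ p0 _ _ _ _ (\bigcup_(e <- r) large_fragments e w) HHf).
  apply: le_trans (cost_bigcup p0 _ _) _; apply: le_trans cw; apply: ler_sum => e _.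
  apply: le_trans (cost_imset p0 _ _) _.
  by under eq_bigl do rewrite inE.
move=> S SH; have kT : (#|T| < 2 ^ (e0 + #|T|).+1)%N.
  by apply: leq_trans (ltn_expl #|T| (isT : (1 < 2)%N)) _; rewrite leq_exp2l //; lia.
have [[e [t [er gt tS te]]]|[t [st tS te]]] := descent blk a w N0 SH kT; [left|right].
  exists (supp t) => //; rewrite (big_rem e) /=; last by rewrite mem_index_iota ltnS.
  by rewrite in_setU; apply/orP; left; apply/imsetP; exists t => //; rewrite inE gt.
by exists (supp t) => //; apply/imsetP; exists t => //; rewrite inE st.
Qed.

Lemma small_fragmentP e (w : labelling) U : U \in small_fragments e w ->
  (#|U| < 2 ^ e.+1)%N /\ exists (Z : labelling) n S,
  witness HH blk a e Z n S /\ [set x | (Z x < N)%N] \subset [set x | (w x < N)%N] :|: U.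
Proof.
case/imsetP => t; rewrite inE => /andP[/existsP[S wS] tU] ->; split=> //.
exists (minl w t), (cnt t), S; split=> //; apply/subsetP => x.
by rewrite !inE minlE gtn_min.
Qed.

End Reduction.

Lemma max_weight_mono (R : realType) (T : finType) (lambda : {set T} -> T -> R)
    (HH : {set {set T}}) (W W' : {set T}) :
  (forall H, H \in HH -> forall x, 0 <= lambda H x) -> W \subset W' ->
  max_weight lambda HH W <= max_weight lambda HH W'.
Proof.
move=> l0 WW'; apply: le_bigmax2 => H HHH.
rewrite big_mkcond [leRHS]big_mkcond; apply: ler_sum => x _.
rewrite !inE; case xW: (x \in W) => /=; first by rewrite (subsetP WW').
by case: ifP => // _; exact: l0.
Qed.

Section FailureProbability.
Variables (R : realType) (T : finType) (p : R) (HH : {set {set T}}).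
Variables (lambda : {set T} -> T -> R) (s : nat).
Hypotheses (p0 : 0 < p) (s0 : (0 < s)%N) (HHf : cover_free p (1 / 2) HH).
Hypothesis lambda_ge0 : forall H, H \in HH -> forall x, 0 <= lambda H x.
Hypothesis lambda_sum : forall H, H \in HH -> 1 <= \sum_(x in H) lambda H x.

(** The choice of [a] gives [4 / 2 ^+ a = 2 ^- s], and [e0] leaves small fragments with at most
    [2 * s] points. The density [q1] gives [256 * (p / q1) = 2 ^- 6], and [m] gives
    [4 ^+ (2 * s) * 2 ^- m = 2 ^- s.+2]. *)
Let a := (s + 2)%N.
Let N := (2 * a)%N.
Let e0 := trunc_log 2 s.
Let q1 := 2 ^+ 14 * p.
Let q2 := 32 * p.
Let m := (5 * s + 2)%N.
Notation labelling := (labelling T N).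
Let blk := block lambda a.

Let fail W := ~~ (1 - 2 ^- s <= max_weight lambda HH W).

Lemma e0_bounds : (2 ^ e0 <= s < 2 ^ e0.+1)%N.
Proof. exact: trunc_log_bounds. Qed.

Lemma a_gt0 : (0 < a)%N. Proof. by rewrite /a addn2. Qed.

Lemma expected_total_cost : N%:R * q1 <= 1 ->
  \sum_(w : labelling) label_mass q1 w * total_cost HH blk a p e0 w <= 2 ^- (s + 4).
Proof.
move=> Nq; have q10 : 0 < q1 by rewrite mulr_gt0 ?exprn_gt0.
under eq_bigr do rewrite /total_cost big_distrr /=.
rewrite exchange_big /=.
have /andP[_ se0] := e0_bounds; apply: le_trans (tail_cost R _ #|T|.+1 se0).
apply: ler_sum => e _.
apply: le_trans (expected_stage_cost a_gt0 (erefl _) _ p0 q10 Nq e) _.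
  by move=> S k _; exact: block_size a_gt0 S k.
suff -> : 256 * (p / q1) = 2 ^- 6 by [].
by rewrite /q1; field; rewrite lt0r_neq0.
Qed.

Lemma small_fragment_success (w : labelling) (U B : {set T}) : U \in small_fragments HH blk a e0 w ->
  U \subset B -> ~~ fail ([set x | (w x < N)%N] :|: B).
Proof.
move=> /small_fragmentP[_ [Z [n [S [wS ZU]]]]] UB; rewrite negbK.
have /witnessP[SH _ _] := wS; set Y := _ :|: B.
have ZY : [set x | (Z x < N)%N] \subset Y by apply: subset_trans ZU _; exact: setUS.
have := witness_weight a_gt0 (erefl _) wS ZY (lambda_ge0 SH).
have -> : 4 / 2 ^+ a = 2 ^- s :> R.
  by rewrite /a exprD; field; rewrite lt0r_neq0 // exprn_gt0.
have s1 : 0 <= 1 - 2 ^- s :> R.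
  by rewrite subr_ge0 invf_le1 ?exprn_gt0 // exprn_ege1 // ler1n.
move=> H; apply: (@le_trans _ _ (\sum_(x in Y :&: S) lambda S x)).
  by apply: le_trans H; rewrite ler_peMr // lambda_sum.
exact: (le_bigmax_cond _ (fun H => \sum_(x in Y :&: H) lambda H x)) SH.
Qed.

Lemma failure_second_phase (w : labelling) : m%:R * q2 < 1 ->
  total_cost HH blk a p e0 w <= 1 / 4 ->
  random_subset_prob (m%:R * q2) (fun B => fail ([set x | (w x < N)%N] :|: B)) <= 2 ^- s.+2.
Proof.
move=> mq cw; have N0 : (0 < N)%N by rewrite /N muln_gt0 a_gt0.
have Ff := small_fragments_cover_free p0 N0 HHf cw.
set F := small_fragments _ _ _ _ _ in Ff.
have q20 : 0 < q2 by rewrite mulr_gt0.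
apply: (@le_trans _ _ (random_subset_prob (m%:R * q2) (fun B => ~~ hits F B))).
  apply: le_prob; first by rewrite mulr_ge0 // ltW.
  move=> B; apply: contraL => /existsP[U /andP[UF UB]].
  exact: small_fragment_success UF UB.
apply: le_trans (@hits_rounds _ _ _ p0 q2 (2 * s) m F (erefl _) mq _ _) _.
- move=> U /small_fragmentP[Us _]; rewrite ltnW // (leq_trans Us) // expnS leq_mul2l.
  by case/andP: e0_bounds.
- move=> G /Ff; apply: le_lt_trans; rewrite ler_pM2r ?invr_gt0 // lerBlDr lerDl.
  by rewrite invr_ge0 exprn_ge0.
have -> : 4 = 2 ^+ 2 :> R by field.
rewrite -exprM (_ : m = 2 * (2 * s) + s.+2)%N; last by rewrite /m; lia.
by rewrite exprD invfM mulrA divff ?mul1r // lt0r_neq0 // exprn_gt0.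
Qed.

(** The total cost of the first phase exceeds 1/4 with probability at most [4 * 2 ^- (s + 4)] by
    Markov; otherwise the second phase fails with probability at most [2 ^- s.+2], the same
    number. *)
Lemma failure_prob (q : R) : N%:R * q1 + m%:R * q2 <= q -> q < 1 ->
  random_subset_prob q fail <= 2 ^- s.+1.
Proof.
move=> qq q1'; have q10 : 0 < q1 by rewrite mulr_gt0 ?exprn_gt0.
have q20 : 0 < q2 by rewrite mulr_gt0.
have Nq0 : 0 <= N%:R * q1 by rewrite mulr_ge0 // ltW.
have mq0 : 0 <= m%:R * q2 by rewrite mulr_ge0 // ltW.
have fail_anti (W W' : {set T}) : W \subset W' -> fail W' -> fail W.
  by move=> WW'; apply: contra => /le_trans; apply; exact: max_weight_mono.
have Nq : N%:R * q1 <= 1 by lra.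
have mq : m%:R * q2 < 1 by lra.
have dm : 0 <= N%:R * q1 + m%:R * q2 by lra.
apply: le_trans (prob_antimono dm qq (ltW q1') fail_anti) _.
apply: le_trans (prob_sprinkle Nq0 mq0 _ fail_anti) _; first by lra.
rewrite -(sum_label_mass_covered Nq
  (fun A => random_subset_prob (m%:R * q2) (fun B => fail (A :|: B)))).
rewrite (bigID (fun w => 1 / 4 < total_cost HH blk a p e0 w)) /=.
have mass0 (w : labelling) : 0 <= label_mass q1 w by exact: label_mass_ge0.
have -> : 2 ^- s.+1 = 2 ^- s.+2 + 2 ^- s.+2 :> R.
  by rewrite !exprS; field; rewrite lt0r_neq0 // exprn_gt0.
have cost0 w : 0 <= total_cost HH blk a p e0 (w : labelling).
  by apply: sumr_ge0 => e _; apply: sumr_ge0 => t _; rewrite exprn_ge0 // ltW.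
apply: lerD.
  apply: (@le_trans _ _ (\sum_(w | 1 / 4 < total_cost HH blk a p e0 (w : labelling))
     label_mass q1 w)).
    by apply: ler_sum => w _; rewrite ler_piMr // prob_le1.
  apply: le_trans (sum_markov _ mass0 cost0) _; first by rewrite divr_gt0.
  apply: le_trans (ler_wpM2l _ (expected_total_cost Nq)) _; first by rewrite invr_ge0 divr_ge0.
  rewrite addn4 !exprS le_eqVlt; apply/orP; left; apply/eqP; field.
  by rewrite lt0r_neq0 // exprn_gt0.
apply: (@le_trans _ _ (\sum_(w : labelling) label_mass q1 w * 2 ^- s.+2)); last first.
  by rewrite -big_distrl /= sum_label_mass ?mul1r.
rewrite big_mkcond; apply: ler_sum => w _; case: ifPn => [|_].
  by rewrite -leNgt => cw; apply: ler_wpM2l => //; exact: failure_second_phase.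
by rewrite mulr_ge0 // invr_ge0 exprn_ge0.
Qed.

End FailureProbability.

Theorem theorem1p4 (R : realType) :
  exists2 C : R, 0 < C &
  forall (T : finType) (p : R) (HH : {set {set T}})
    (lambda : {set T} -> T -> R) (s : nat),
    0 < p <= 1 ->
    ~ p_small p HH ->
    (forall H, H \in HH -> forall x, 0 <= lambda H x <= 1) ->
    (forall H, H \in HH -> forall x, x \notin H -> lambda H x = 0) ->
    (forall H, H \in HH -> 1 <= \sum_(x in H) lambda H x) ->
    (0 < s)%N ->
    1 - 2 ^- s.+1 <=
      random_subset_prob (C * s%:R * p)
        (fun W => 1 - 2 ^- s <= max_weight lambda HH W).
Proof.
(* As [s >= 1], the two phases need density at most [(6 * 2 ^ 14 + 7 * 32) * s * p], below
   [2 ^ 17 * s * p]. *)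
exists (2 ^+ 17) => [|T p HH lambda s /andP[p0 _] Hsmall l01 _ lsum s0]; first exact: exprn_gt0.
have l0 H : H \in HH -> forall x, 0 <= lambda H x by move=> HHH x; case/andP: (l01 H HHH x).
have HHf : cover_free p (1 / 2) HH.
  by move=> G GHH; rewrite ltNge; apply/negP => cG; apply: Hsmall; exists G.
set E := fun W => _; set q := _ * p.
suff : random_subset_prob q (fun W => ~~ E W) <= 2 ^- s.+1 by have := probC q E; lra.
have s1 : 1 <= s%:R :> R by rewrite ler1n.
have [q1|q1] := ltP q 1.
  apply: (failure_prob p0 s0 HHf l0 lsum _ q1).
  have sp : p <= s%:R * p by rewrite ler_peMl // ltW.
  by rewrite /q !(natrM, natrD); nra.
(* For [q >= 1] all mass sits on the full set, where a single [H] already has weight at least 1. *)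
have [H HHH] : exists H, H \in HH by apply: cover_free_neq0 HHf; lra.
apply: (@le_trans _ _ 0); last by rewrite invr_ge0 exprn_ge0.
rewrite /random_subset_prob big1 // => W /negP EW.
have [WT|] := eqVneq W setT.
  case: EW; rewrite WT /E; apply: (@le_trans _ _ (\sum_(x in H) lambda H x)).
    apply: le_trans (lsum H HHH); rewrite gerBl invr_ge0 exprn_ge0 //.
  rewrite -{1}[H]setTI.
  exact: (le_bigmax_cond _ (fun H => \sum_(x in setT :&: H) lambda H x)) HHH.
rewrite eqEsubset subsetT /= => /subsetPn[x _ xW].
by rewrite /random_subset_mass (bigD1 x) //= (negbTE xW) min_r // subrr mul0r.
Qed.
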